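(* Let $A\subset\mathbb{R}$ be a finite alphabet, let $S:A\to A^\ast$, and let $(\Omega(S),T)$ be a substitution dynamical system. Then the following are equivalent: (i) There exists an $e\in A$ which satisfies both $|S^n(e)|\to\infty$ as $n\to\infty$ and: for every $a\in A$ there is an $n\in\mathbb{N}$ such that $a$ occurs in $S^n(e)$; and which moreover occurs with bounded gaps. (ii) $(\Omega(S),T)$ is minimal. (iii) $(\Omega(S),T)$ is linearly repetitive.
   Context: $A$ is a finite subset of $\mathbb{R}$ (the alphabet), $A^\ast$ is the free monoid of words over $A$, $|w|$ is the length of a word $w$, $\#_v(w)$ is the number of occurrences of $v$ in $w$, $\mathrm{Sub}(u)$ is the set of finite subwords (contiguous factors) of a finite or infinite word $u$, and $\mathbb{N}=\{1,2,\dots\}$, $\mathbb{N}_0=\mathbb{N}\cup\{0\}$. $A^{\mathbb{Z}}$ carries the product of the discrete topologies and $T$ is the shift, $(T\omega)(n)=\omega(n+1)$. A subshift is $(\Omega,T)$ with $\Omega\subset A^{\mathbb{Z}}$ closed and $T$-invariant; $\mathcal{W}(\Omega)=\bigcup_{\omega\in\Omega}\mathrm{Sub}(\omega)$. A map $S:A\to A^\ast$ is extended to a morphism $S:A^\ast\to A^\ast$ by concatenation. Put $\mathcal{W}(S)=\{w\in A^\ast: w\in\mathrm{Sub}(S^n(a))\text{ for some }a\in A,\ n\in\mathbb{N}_0\}$ and $\Omega(S)=\{\omega\in A^{\mathbb{Z}}:\mathrm{Sub}(\omega)\subset\mathcal{W}(S)\}$. $(\Omega(S),T)$ is called a substitution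 dynamical system if there exists $e\in A$ with $|S^n(e)|\to\infty$ as $n\to\infty$ and such that for every $a\in A$ there is $n\in\mathbb{N}$ with $\#_a(S^n(e))\ge 1$, and if in addition $\mathcal{W}(S)=\mathcal{W}(\Omega(S))$. A word $v\in\mathcal{W}(\Omega)$ occurs with bounded gaps if there is $L_v>0$ such that every $w\in\mathcal{W}(\Omega)$ with $|w|\ge L_v$ contains a copy of $v$. $(\Omega,T)$ is minimal if every orbit is dense in $\Omega$ (equivalently, every $v\in\mathcal{W}(\Omega)$ occurs with bounded gaps). $(\Omega,T)$ is linearly repetitive if there is a constant $C_{\mathrm{LR}}$ such that for all $v,w\in\mathcal{W}(\Omega)$, $|w|\ge C_{\mathrm{LR}}|v|$ implies $\#_v(w)\ge 1$. *)

(* Defs.v *)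
From mathcomp Require Import all_boot all_order all_algebra finmap.
From mathcomp Require Import all_classical all_reals all_analysis.

Set Implicit Arguments.
Unset Strict Implicit.
Unset Printing Implicit Defensive.

Import Order.TTheory GRing.Theory Num.Theory.

Local Open Scope classical_set_scope.
Local Open Scope ring_scope.

Section SubstitutionSystems.
Context {R : realType} {A : {fset R}}.

(* A^Z with the product of the discrete topologies *)
Definition full_shift : Type :=
  prod_topology (fun _ : int => discrete_topology A).

Implicit Types (u v w : seq A) (omega : full_shift) (Omega : set full_shift).
Implicit Types (S : A -> seq A) (a e : A).

(* The number of (possibly overlapping) occurrences of v in w, counted by
   their starting positions. *)
Definition occurrences v w : nat :=
  count (fun i => prefix v (drop i w)) (iota 0 (size w).+1).

Definition left_shift omega : full_shift := fun n => omega (n + 1).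

(* The two-sided orbit {T^n omega : n in Z}: as T is invertible,
   eta = T^(-n) omega iff omega = T^n eta. *)
Definition shift_orbit omega : set full_shift :=
  [set eta | exists n : nat,
    eta = iter n left_shift omega \/ omega = iter n left_shift eta].

Definition factors omega : set (seq A) :=
  [set w | exists i : int, w = mkseq (fun k => omega (i + k%:Z) : A) (size w)].

(* W(Omega) *)
Definition language Omega : set (seq A) :=
  [set w | exists2 omega, Omega omega & factors omega w].

Definition bounded_gaps Omega v : Prop :=
  language Omega v /\
  exists2 L : R, 0 < L &
    forall w, language Omega w -> L <= (size w)%:R -> infix v w.

Definition minimal_shift Omega : Prop :=
  forall omega, Omega omega -> Omega `<=` closure (shift_orbit omega).

Definition linearly_repetitive Omega : Prop :=
  exists C : R, forall v w, language Omega v -> language Omega w ->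
    C * (size v)%:R <= (size w)%:R -> (1 <= occurrences v w)%N.

Definition morphism S w : seq A := flatten (map S w).

(* W(S); the witness n ranges over N_0 = {0, 1, ...} *)
Definition subst_language S : set (seq A) :=
  [set w | exists a, exists n : nat, infix w (iter n (morphism S) [:: a])].

(* Omega(S) *)
Definition subst_shift S : set full_shift :=
  [set omega | factors omega `<=` subst_language S].

Definition growing S e : Prop :=
  size (iter n (morphism S) [:: e]) @[n --> \oo] --> \oo.

Definition generates_letters S e : Prop :=
  forall a, exists2 n : nat, (1 <= n)%N &
    (1 <= occurrences [:: a] (iter n (morphism S) [:: e]))%N.

Definition substitution_system S : Prop :=
  (exists e, growing S e /\ generates_letters S e) /\
  subst_language S = language (subst_shift S).

End SubstitutionSystems.

Arguments full_shift {R} A.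

(* Main.v *)
(* (i) => (iii): a factor w of S^m(x) lies in S^m(b z c) and contains S^m(z),
   where b z c is a factor of x and |b|, |c| <= 1.  Given v, take m least with
   |S^m(e)| > |v|.  Then z avoids e, so v lies in S^m(x) for one of finitely many
   x, hence in S^(m+p)(e) with p bounded; and every w longer than a constant times
   max_a |S^(m+p)(a)| contains S^(m+p)(e).  That maximum is at most a constant
   times |v|, since every letter occurs in some S^k(e).
   (iii) => (ii): repetitivity brings every central factor of one point into the
   forward orbit of any other at the same place.
   (ii) => (i): points avoiding a word v near 0 on ever larger windows
   accumulate, by compactness, at a point avoiding v altogether. *)
Require Import Defs.
From mathcomp Require Import all_boot all_order all_algebra finmap.
From mathcomp Require Import all_classical all_reals all_analysis.
From mathcomp Require Import zify.

Set Implicit Arguments.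
Unset Strict Implicit.
Unset Printing Implicit Defensive.

Import Order.TTheory GRing.Theory Num.Theory.

Local Open Scope nat_scope.
Local Open Scope classical_set_scope.

(** * Cutting factors of a morphic image along the images of letters *)

Section Desubstitution.
Variables (T U : eqType) (f : T -> seq U).
Local Notation "'F' x" := (flatten (map f x)) (at level 10).

(** The cut meets the image of at most one letter. That letter is kept as a word [b], which is empty
    only when the whole of [x] lies before the cut. *)
Lemma flatten_map_split x p q : F x = p ++ q ->
  exists x1 b x2 p' q', [/\ x = x1 ++ b ++ x2, size b <= 1, p = F x1 ++ p',
    F b = p' ++ q' & q = q' ++ F x2].
Proof.
elim: x p => [|a x IH] p /=.
  by case: p => //= <-; exists [::], [::], [::], [::], [::].
move=> E; have [le_ap|lt_pa] := leqP (size (f a)) (size p).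
  have Ea : f a = take (size (f a)) p.
    by have /(congr1 (take (size (f a)))) := E; rewrite take_size_cat // takel_cat.
  move: E; rewrite -{1}(cat_take_drop (size (f a)) p) -Ea -catA => /eqP.
  rewrite eqseq_cat // eqxx /= => /eqP /IH [x1 [b [x2 [p' [q' [-> sb Ep Eb Eq]]]]]].
  exists (a :: x1), b, x2, p', q'; split => //=.
  by rewrite -catA -Ep {1}Ea cat_take_drop.
exists [::], [:: a], x, p, (drop (size p) (f a)); split => //=.
- rewrite cats0.
  have -> : p = take (size p) (f a).
    have /(congr1 (take (size p))) := E.
    by rewrite takel_cat 1?ltnW // take_size_cat.
  by rewrite size_take lt_pa cat_take_drop.
- have /(congr1 (drop (size p))) := E.
  by rewrite drop_cat lt_pa drop_size_cat.
Qed.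

(** Cut at the start of [w], then at its end: the letters [b] and [c] met by the cuts may be covered
    only in part, those of [z] between them entirely. *)
Lemma desubstitution w x : infix w (F x) ->
  exists b z c, [/\ size b <= 1, size c <= 1, infix (b ++ z ++ c) x,
    infix w (F (b ++ z ++ c)) & infix (F z) w].
Proof.
case/infixP => p [s /flatten_map_split].
move=> [x1 [b [x2 [p' [q' [-> sb _ Eb Ews]]]]]].
(* In the first case [w] already ends inside the image of [b]. *)
have [le_wq|lt_qw] := leqP (size w) (size q').
  exists b, [::], [::]; split => //.
  - by rewrite /= cats0 infix_infix.
  - have -> : w = take (size w) q'.
      have /(congr1 (take (size w))) := Ews.
      by rewrite take_size_cat // takel_cat.
    rewrite /= cats0 Eb -{2}(cat_take_drop (size w) q').
    exact: infix_infix.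
  - by rewrite /= infix0s.
have Ew : w = q' ++ drop (size q') w.
  have /(congr1 (take (size q'))) := Ews.
  by rewrite takel_cat 1?ltnW // take_size_cat // => {1}<-; rewrite cat_take_drop.
move: Ews; rewrite {1}Ew -catA => /eqP; rewrite eqseq_cat // eqxx /= => /eqP/esym.
case/flatten_map_split => z [c [y [r [t [-> sc Er Ec _]]]]].
exists b, z, c; split => //.
- by apply/infixP; exists x1, y; rewrite -!catA.
- rewrite Ew Er !map_cat !flatten_cat Eb Ec.
  by apply/infixP; exists p', t; rewrite !catA.
- by rewrite Ew Er; exact: infix_infix.
Qed.

Lemma size_flatten_map K x :
  (forall a, size (f a) <= K) -> size (F x) <= K * size x.
Proof.
move=> fK; elim: x => //= a x IH.
by rewrite size_cat mulnS leq_add.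
Qed.

End Desubstitution.

(** * Growth and recurrence of the iterates of [S] *)

Section Words.
Context {R : realType} {A : {fset R}} (S : A -> seq A).
Implicit Types (u v w x : seq A) (a e : A).
Local Notation "S^ n" := (iter n (morphism S)) (at level 2, n at level 2).

Definition max_image_size m : nat := \max_(a : A) size (S^m [:: a]).
Local Notation M := max_image_size.

Lemma infix_trans u v w : infix u v -> infix v w -> infix u w.
Proof.
move=> /infixP[p [s ->]] /infixP[p' [s' ->]].
by apply/infixP; exists (p' ++ p), (s ++ s'); rewrite !catA.
Qed.

Lemma iter_morphism_cat n u v : S^n (u ++ v) = S^n u ++ S^n v.
Proof. by elim: n => //= n ->; rewrite /morphism map_cat flatten_cat. Qed.

Lemma iter_morphism_nil n : S^n [::] = [::].
Proof. by elim: n => //= n ->. Qed.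

Lemma iter_morphismE n x : S^n x = flatten [seq S^n [:: a] | a <- x].
Proof.
elim: x => [|a x IH]; first by rewrite iter_morphism_nil.
by rewrite -cat1s iter_morphism_cat IH.
Qed.

Lemma infix_iter_morphism n u v : infix u v -> infix (S^n u) (S^n v).
Proof.
by move=> /infixP[p [s ->]]; rewrite !iter_morphism_cat; exact: infix_infix.
Qed.

Lemma subst_language_infix u v :
  infix u v -> subst_language S v -> subst_language S u.
Proof. by move=> uv [a [n vn]]; exists a, n; exact: infix_trans vn. Qed.

Lemma size_iter_morphism m x : size (S^m x) <= M m * size x.
Proof.
rewrite iter_morphismE; apply: size_flatten_map => a.
exact: (leq_bigmax (F := fun a => size (S^m [:: a]))).
Qed.

Lemma occurrences_gt0 v w : (0 < occurrences v w) = infix v w.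
Proof.
rewrite /occurrences -has_count; apply/hasP/idP => [[i _ /prefixP[s E]]|].
  by rewrite -(cat_take_drop i w) E infix_infix.
move=> /infixP[p [s ->]]; exists (size p).
  by rewrite mem_iota /= add0n ltnS size_cat leq_addr.
by rewrite drop_size_cat // prefix_prefix.
Qed.

Section Generator.
Variables (e : A) (eS : generates_letters S e).

Lemma letter_in_image a : exists2 n, 0 < n & infix [:: a] (S^n [:: e]).
Proof. by have [n n0] := eS a; rewrite occurrences_gt0; exists n. Qed.

(** Since [e] occurs in some [S^j(e)] with [j > 0], it occurs in every [S^(t * j)(e)], so the
    exponent can be pushed past any [m]. *)
Lemma subst_language_generator w m :
  subst_language S w -> exists2 n, m <= n & infix w (S^n [:: e]).
Proof.
move=> [a [N wN]].
have [k _ ak] := letter_in_image a; have [j j0 ej] := letter_in_image e.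
have ejt t : infix [:: e] (S^(t * j) [:: e]).
  elim: t => [|t IH]; first by rewrite mul0n infix_refl.
  rewrite mulSn iterD; apply: infix_trans ej _.
  exact: (infix_iter_morphism _ IH).
exists (N + (k + m * j)); first by nia.
apply: infix_trans wN _; rewrite iterD; apply: infix_iter_morphism.
by apply: infix_trans ak _; rewrite iterD; exact: infix_iter_morphism.
Qed.

(** If [a] occurs in [S^k(e)], then [S^m(a)] is a factor of [S^m(S^k(e)) = S^k(S^m(e))], whose
    length is at most [M k] times that of [S^m(e)]. *)
Lemma max_image_size_generator : exists D, forall m, M m <= D * size (S^m [:: e]).
Proof.
have [k /all_and2[_ ek]] : exists k : A -> nat,
    forall a, 0 < k a /\ infix [:: a] (S^(k a) [:: e]).
  apply: (fin_all_exists (P := fun a n => 0 < n /\ infix [:: a] (S^n [:: e]))).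
  by move=> a; have [n] := letter_in_image a; exists n.
exists (\max_(a : A) M (k a)) => m; apply/bigmax_leqP => a _.
apply: leq_trans (size_infix (infix_iter_morphism m (ek a))) _.
rewrite -iterD addnC iterD; apply: leq_trans (size_iter_morphism _ _) _.
by rewrite leq_mul2r (leq_bigmax (F := fun a => M (k a))) orbT.
Qed.

(** The type [{bseq l of A}] is finite, so the exponents have a maximum; words outside the language
    get the dummy exponent 0. *)
Lemma short_words_generator l : exists P, forall x, subst_language S x ->
  size x <= l -> exists2 p, p <= P & infix x (S^p [:: e]).
Proof.
have [k ek] : exists k : {bseq l of A} -> nat,
    forall x : {bseq l of A}, subst_language S x -> infix x (S^(k x) [:: e]).
  apply: (fin_all_exists (P := fun (x : {bseq l of A}) n =>
    subst_language S x -> infix x (S^n [:: e]))) => x.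
  have [/(subst_language_generator 0)[n _ xn]|] := pselect (subst_language S x).
    by exists n.
  by exists 0.
exists (\max_x k x) => x xS xl.
exists (k (Bseq xl)); first exact: leq_bigmax.
exact: (ek (Bseq xl)).
Qed.

Variables (L : nat).
Hypothesis eL : forall w, subst_language S w -> L <= size w -> infix [:: e] w.

Lemma desubstitution_generator m w : subst_language S w ->
  exists x, [/\ subst_language S x, infix w (S^m x) &
    size x <= L.+1 \/ infix (S^m [:: e]) w].
Proof.
move=> /(subst_language_generator m)[n mn].
rewrite -(subnKC mn) iterD iter_morphismE.
case/desubstitution => b [z [c [sb sc bzc wbzc zw]]].
have bzcS : subst_language S (b ++ z ++ c) by exists e, (n - m).
exists (b ++ z ++ c); split; rewrite // ?iter_morphismE //.
have [Lz|zL] := leqP L (size z); last first.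
  (* Fewer than [L] letters in [z], and at most one in each of [b] and [c]. *)
  left; rewrite !size_cat -add1n leq_add //.
  by apply: leq_trans (leq_add (leqnn _) sc) _; rewrite addn1.
right; apply: infix_trans zw; rewrite -!iter_morphismE.
apply/infix_iter_morphism/eL => //.
exact: (subst_language_infix (infix_infix _ _ _) bzcS).
Qed.

Lemma long_word_contains m w : subst_language S w ->
  M m * L.+1 < size w -> infix (S^m [:: e]) w.
Proof.
move=> /(desubstitution_generator m)[x [_ wx [xL|//]]] Mw.
have := leq_trans Mw (leq_trans (size_infix wx) (size_iter_morphism m x)).
by rewrite ltnNge leq_mul2l xL orbT.
Qed.

Lemma subst_language_linearly_repetitive : growing S e ->
  exists C, forall v w, subst_language S v -> subst_language S w ->
    C * size v <= size w -> infix v w.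
Proof.
move=> /cvgnyPgt eoo.
have [D MD] := max_image_size_generator.
have [P wP] := short_words_generator L.+1.
pose K := \max_(p < P.+1) M p.
(* The product comes from the estimates [h1] and [h2]; the successor makes the final bound strict,
   as [v] is nonempty there. *)
exists (D * K * M 1 * L.+1).+1 => v w vS wS vw.
have [->|v0] := eqVneq v [::]; first exact: infix0s.
have exm : exists m, size v < size (S^m [:: e]).
  by have [m _ /(_ m (leqnn m))] := eoo (size v); exists m.
(* A least exponent 0 would force [v] to be empty. So it is a successor, and the preceding iterate
   of [e] is no longer than [v]. *)
have [[|m]] := ex_minnP exm.
  by move=> /=; case: (v) v0.
move=> mv m_min.
have mv' : size (S^m [:: e]) <= size v.
  by rewrite leqNgt; apply/negP => /m_min; rewrite ltnn.
have [x [xS vx [xL|/size_infix]]] := desubstitution_generator m.+1 vS; last first.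
  by move=> /(leq_trans mv); rewrite ltnn.
have [p pP xp] := wP _ xS xL.
apply: (@infix_trans _ (S^(m.+1 + p) [:: e])).
  by apply: infix_trans vx _; rewrite iterD; exact: infix_iter_morphism.
apply: long_word_contains => //; apply: leq_trans vw.
have pK : M p <= K.
  exact: (leq_bigmax (F := fun i : 'I_P.+1 => M i) (Ordinal (pP : p < P.+1))).
(* Apply [S^m], then [S], then [S^p]: the lengths grow by factors of at most [M 1] and [K]. *)
have h1 : size (S^(m.+1 + p) [:: e]) <= K * (M 1 * size v).
  rewrite addnC iterD; apply: leq_trans (size_iter_morphism _ _) _.
  apply: leq_mul => //; apply: leq_trans (size_iter_morphism 1 _) _.
  by rewrite leq_mul2l mv' orbT.
have h2 : M (m.+1 + p) * L.+1 <= D * (K * (M 1 * size v)) * L.+1.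
  by rewrite leq_mul2r (leq_trans (MD _)) ?orbT // leq_mul2l h1 orbT.
have v1 : 0 < size v by rewrite lt0n size_eq0.
nia.
Qed.

End Generator.
End Words.

(** * Windows, translates and the product topology of the full shift *)

Section Shifts.
Context {R : realType} {A : {fset R}}.
Implicit Types (omega eta xi : full_shift A) (v w : seq A) (i j : int).

Definition factor_at omega i n : seq A :=
  mkseq (fun k => omega (i + k%:Z)%R : A) n.

Definition translate j omega : full_shift A := fun i => omega (i + j)%R.

Lemma iter_left_shift n omega : iter n left_shift omega = translate n omega.
Proof.
elim: n => [|n IH] /=; first by apply/funext => i; rewrite /translate addr0.
apply/funext => i; rewrite IH /left_shift /translate.
by rewrite -addrA; congr (omega (_ + _)%R); lia.
Qed.

Lemma factor_at_translate j omega i n :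
  factor_at (translate j omega) i n = factor_at omega (i + j)%R n.
Proof. by apply: eq_mkseq => k; rewrite /translate addrAC. Qed.

Lemma infix_factor_at omega i j m n : (i <= j)%R -> (j + m%:Z <= i + n%:Z)%R ->
  infix (factor_at omega j m) (factor_at omega i n).
Proof.
move=> ij jm; set d := `|j - i|%N.
have -> : n = d + (m + (n - m - d)) by rewrite /d; lia.
rewrite /factor_at /mkseq !iotaD !map_cat add0n.
have -> : [seq omega (j + k%:Z)%R : A | k <- iota 0 m] =
          [seq omega (i + k%:Z)%R : A | k <- iota d m].
  rewrite -[d in RHS]addn0 iotaDl -map_comp; apply: eq_map => k /=.
  by congr omega; rewrite /d; lia.
exact: infix_infix.
Qed.

Lemma factor_at_cat omega i n p v s : factor_at omega i n = p ++ v ++ s ->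
  v = factor_at omega (i + (size p)%:Z)%R (size v).
Proof.
move=> E; have sE : n = size p + (size v + size s).
  by rewrite -!size_cat -E size_mkseq.
apply: (@eq_from_nth _ (omega 0%R)) => [|k kv]; first by rewrite size_mkseq.
have /(congr1 (fun u => nth (omega 0%R : A) u (size p + k))) := E.
rewrite !nth_mkseq //; last by rewrite sE ltn_add2l ltn_addr.
rewrite nth_cat ltnNge leq_addr /= addKn nth_cat kv => <-.
by rewrite -addrA; congr omega.
Qed.

Lemma nbhs_coordinate omega i : nbhs omega [set xi | xi i = omega i].
Proof.
exact: (@proj_continuous int (fun=> discrete_topology A) i omega _
  (@discrete_set1 (discrete_topology A) (omega i))).
Qed.

Lemma nbhs_factor_at omega i n :
  nbhs omega [set xi | factor_at xi i n = factor_at omega i n].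
Proof.
elim: n => [|n IH]; first exact: filterS filterT.
apply: filterS (filterI IH (nbhs_coordinate omega (i + n%:Z)%R)).
move=> xi [/= xi1 xi2].
rewrite -addn1 /factor_at /mkseq !iotaD !map_cat /= add0n xi2.
by congr (_ ++ _).
Qed.

(** Convergence in the product is coordinatewise, and coordinate [i] is constant from index [|i|]
    on. *)
Lemma cvg_coordinates (xi_ : nat -> full_shift A) omega :
  (forall n i, (`|i| <= n%:Z)%R -> xi_ n i = omega i) ->
  xi_ n @[n --> \oo] --> omega.
Proof.
move=> xiE; apply/cvg_sup => i; apply/cvg_image.
  by rewrite eqEsubset; split => // a _; exists (fun=> a).
move=> B /nbhs_singleton Bi; exists ((fun xi => xi i) @^-1` B).
  exists `|i|%N => // n /= le_in; rewrite xiE //; lia.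
by apply: image_preimage; rewrite eqEsubset; split => // a _; exists (fun=> a).
Qed.

Lemma compact_full_shift : compact [set: full_shift A].
Proof.
have -> : [set: full_shift A] = [set xi | forall i, [set: A] (xi i)].
  by apply/seteqP; split.
apply: (@tychonoff int (fun=> discrete_topology A) (fun=> setT)) => i.
exact/finite_compact/(@finite_finset A).
Qed.

End Shifts.

(** * Minimality, repetitivity and bounded gaps for the substitution shift *)

Section SubstShift.
Context {R : realType} {A : {fset R}} (S : A -> seq A).
Implicit Types (omega eta xi : full_shift A) (v w : seq A) (i j : int).
Local Notation Omega := (subst_shift S).

Lemma subst_shiftP omega :
  Omega omega <-> forall i n, subst_language S (factor_at omega i n).
Proof.
split=> [Oo i n|Oo w [i ->]]; last exact: Oo.
by apply: Oo; exists i; rewrite size_mkseq.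
Qed.

Lemma languageP (O : set (full_shift A)) w :
  language O w <-> exists omega i, O omega /\ w = factor_at omega i (size w).
Proof.
split=> [[omega Oo [i wE]]|[omega [i [Oo wE]]]].
  by exists omega, i.
by exists omega => //; exists i.
Qed.

Lemma language_factor_at (O : set (full_shift A)) omega i n :
  O omega -> language O (factor_at omega i n).
Proof. by move=> Oo; apply/languageP; exists omega, i; rewrite size_mkseq. Qed.

Lemma subst_shift_translate omega j : Omega omega -> Omega (translate j omega).
Proof.
move=> /subst_shiftP Oo; apply/subst_shiftP => i n.
by rewrite factor_at_translate.
Qed.

Lemma linearly_repetitive_minimal :
  linearly_repetitive Omega -> minimal_shift Omega.
Proof.
move=> [C CP] omega Oo eta Oeta.
(* The window of [eta] on [[-n, n]] is sought in a long window of [omega] starting at 0, so that it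
   is found at some [j >= 0]. *)
have /choice[j_ jE] : forall n : nat, exists j : nat,
    factor_at omega j n.*2.+1 = factor_at eta (- n%:Z)%R n.*2.+1.
  move=> n; set v := factor_at eta _ _.
  have [N CN] : exists N : nat, (C * n.*2.+1%:R <= N%:R)%R.
    by exists (Num.bound (C * n.*2.+1%:R)%R); rewrite ltW // unstable.ltr_bound.
  have := CP v (factor_at omega 0%R N) (language_factor_at _ _ Oeta)
    (language_factor_at _ _ Oo).
  rewrite !size_mkseq occurrences_gt0 => /(_ CN) /infixP[p [s E]].
  by exists (size p); rewrite (factor_at_cat E) add0r size_mkseq.
(* This shift carries position [j_ n] of [omega] to [-n], where the window of [eta] starts. *)
have xi_eta : translate (j_ n + n)%N omega @[n --> \oo] --> eta.
  apply: cvg_coordinates => n i in_n.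
  have k_lt : (`|(i + n%:Z)%R|)%N < n.*2.+1 by lia.
  have /(congr1 (fun u => nth (omega 0%R : A) u `|(i + n%:Z)%R|%N)) := jE n.
  rewrite !nth_mkseq // => E; rewrite /translate.
  transitivity (omega (j_ n + `|(i + n%:Z)%R|%N)%R); first by congr omega; lia.
  by rewrite E; congr eta; lia.
move=> B /xi_eta [N _ /(_ N (leqnn N)) BN].
exists (translate (j_ N + N)%N omega); split => //.
by exists (j_ N + N); left; rewrite iter_left_shift.
Qed.

Lemma minimal_bounded_gaps v :
  minimal_shift Omega -> language Omega v -> bounded_gaps Omega v.
Proof.
move=> minO Ov; split=> //; apply: contrapT => gaps.
(* A word of length at least [2n + 1 + |v|] without [v] leaves [2n + 1] starting positions free of
   [v]; translating by [i + n] centres them at 0. *)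
have /choice[om_ omP] : forall n : nat, exists om : full_shift A, Omega om /\
    forall i, (`|i| <= n%:Z)%R -> factor_at om i (size v) <> v.
  move=> n; apply: contrapT => no_om; apply: gaps.
  exists (n.*2.+1 + size v)%:R%R; first by rewrite ltr0n.
  move=> w Ow; rewrite ler_nat => wn; apply: contrapT => vw; apply: no_om.
  have /languageP[omega [i [Oo wE]]] := Ow.
  exists (translate (i + n%:Z)%R omega).
  split; first exact: subst_shift_translate.
  move=> j jn vE; apply: vw; rewrite wE -vE factor_at_translate.
  by apply: infix_factor_at; lia.
have [omega [_ om_omega]] :=
  compact_full_shift (F := om_ @ \oo) _ (filterT : (om_ @ \oo) setT).
(* As [omega] is a cluster point, each of its windows is shared by some [om_ m] with [m] arbitrarily
   large. *)
have omega_near (N : nat) i n : exists2 m : nat, N <= m &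
    factor_at (om_ m) i n = factor_at omega i n.
  have [|xi [[m Nm <-] omE]] := om_omega (om_ @` [set m | N <= m])
      _ _ (nbhs_factor_at omega i n); last by exists m.
  by exists N => // m Nm; exists m.
have Oo : Omega omega.
  apply/subst_shiftP => i n; have [m _ <-] := omega_near 0 i n.
  by have [/subst_shiftP] := omP m.
have no_v i : factor_at omega i (size v) <> v.
  have [m im <-] := omega_near `|i|%N i (size v).
  by apply: (omP m).2; lia.
have /languageP[eta [i [Oeta vE]]] := Ov.
(* By density, the orbit of [omega] meets the cylinder of [eta] that shows [v] at [i]; hence [omega]
   has [v] at [i + n] or [i - n]. *)
have [xi [[n xiE] xi_eta]] :=
  minO _ Oo _ Oeta _ (nbhs_factor_at eta i (size v)).
case: xiE => [xiE|omE].
  apply: (no_v (i + n%:Z)%R).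
  by rewrite -factor_at_translate -iter_left_shift -xiE xi_eta.
apply: (no_v (i - n%:Z)%R); rewrite omE iter_left_shift factor_at_translate.
by rewrite subrK xi_eta.
Qed.

End SubstShift.

Theorem theorem1 (R : realType) (A : {fset R}) (S : A -> seq A)
    (hS : substitution_system S) :
  ((exists e : A, growing S e /\ generates_letters S e /\
      bounded_gaps (subst_shift S) [:: e])
   <-> minimal_shift (subst_shift S)) /\
  (minimal_shift (subst_shift S) <-> linearly_repetitive (subst_shift S)).
Proof.
have [[e [egrow egen]] langS] := hS.
have gaps_lr : (exists e : A, growing S e /\ generates_letters S e /\
    bounded_gaps (subst_shift S) [:: e]) -> linearly_repetitive (subst_shift S).
  move=> [a [agrow [agen [_ [L _ aL]]]]].
  (* The real gap length is rounded up to a natural number. *)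
  have aL' w : subst_language S w -> Num.bound L <= size w -> infix [:: a] w.
    rewrite langS => Ow Lw; apply: aL => //.
    by rewrite (le_trans (ltW (unstable.ltr_bound L))) // ler_nat.
  have [C CP] := subst_language_linearly_repetitive agen aL' agrow.
  exists C%:R%R => v w; rewrite -langS -natrM ler_nat occurrences_gt0.
  exact: CP.
have min_gaps : minimal_shift (subst_shift S) -> exists e : A,
    growing S e /\ generates_letters S e /\ bounded_gaps (subst_shift S) [:: e].
  (* The letter supplied by [hS] serves: [[:: e]] is [S^0(e)], hence in the language of the shift by
     [langS]. *)
  move=> minS; exists e; split=> //; split=> //.
  apply: minimal_bounded_gaps => //; rewrite -langS.
  by exists e, 0; exact: infix_refl.
have lr_min := @linearly_repetitive_minimal R A S.
split; split.
- by move=> /gaps_lr/lr_min.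
- exact: min_gaps.
- by move=> /min_gaps/gaps_lr.
- exact: lr_min.
Qed.
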